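(* For every fixed integer $N\ge1$, $$\delta_p(2,N)\simeq\sqrt{\frac{N^N}{(\pi p)^{N-1}}}\qquad(p\to\infty),$$ where $x_p\simeq y_p$ means $x_p/y_p\to1$.
   Context: For integers $M,N,p\ge1$, $\delta_p(M,N)=\frac{1}{(MN)^p}\#\{(a,b)\in\mathbb Z_M^p\times\mathbb Z_N^p:\{(a_y,b_y)\}_{y=1}^p=\{(a_y,b_{y+1})\}_{y=1}^p\text{ as multisets}\}$, with $b_{p+1}=b_1$. *)

(* Defs.v *)
From mathcomp Require Import all_boot.
From Stdlib Require Import Reals.

Set Implicit Arguments. Unset Strict Implicit. Unset Printing Implicit Defensive.

(* Z_M is represented by the residues 'I_M (only equality is used).
   The cyclic shift y |-> y+1 (with b_{p+1} = b_1) is ordS. *)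
Definition delta_count (M N p : nat) : nat :=
  #|[set ab : {ffun 'I_p -> 'I_M} * {ffun 'I_p -> 'I_N} |
      perm_eq [seq (ab.1 y, ab.2 y) | y <- enum 'I_p]
              [seq (ab.1 y, ab.2 (ordS y)) | y <- enum 'I_p]]|.

Definition delta (p M N : nat) : R :=
  Rdiv (INR (delta_count M N p)) (pow (INR (M * N)) p).

(* Main.v *)
(* The word a is the indicator of a subset A of Z/p, and the multisets agree iff
   b uses every colour equally often on A and on the shift A + 1, hence on
   U = A \ (A + 1) and D = (A + 1) \ A, which have the same size m.  So
   delta_p(2,N) is the average over A of P_N(m), the probability that two
   independent uniform words of length m over N letters have the same histogram.
   The changes of a between consecutive positions of {0, ..., p-1} form an
   arbitrary set of size k, and m is k/2 rounded up; thus k is binomial(p-1, 1/2).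
   Singling out one letter, P_(n+1)(m) = sum_k beta(k)^2 P_n(k) with beta the
   binomial(m, n/(n+1)) law.  Sums of this kind are handled uniformly: if
   f(j) ~ C j^(-d/2) and the weights are dominated by a binomial(n, s) law, then
   f may be replaced by C (s n)^(-d/2), the tails being exponentially small.
   The total weight sum_k beta(k)^2 is again an average of this form, of the
   central binomial probabilities, whose asymptotics is Wallis' product. *)
Require Import Defs.
From Stdlib Require Import Reals.
From Stdlib Require Lra Lia.
From Coquelicot Require Coquelicot.
From mathcomp Require all_boot all_order all_algebra ring lra zify.
From mathcomp Require all_classical reals topology normedtype sequences realfun exp.
From mathcomp Require Rstruct.

(** * Wallis' integrals and two-sided bounds for the central binomial probabilities *)

(* Under ssrnat's notations [1 <= N] in the theorem would be a boolean; hence the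
   imports are confined to modules. *)
Module Wallis.
Import Lra Lia Coquelicot.
Local Open Scope R_scope.

Definition wallis (n : nat) : R := RInt (fun x => sin x ^ n) 0 (PI / 2).

Lemma ex_RInt_sin_pow (n : nat) : ex_RInt (fun x => sin x ^ n) 0 (PI / 2).
Proof.
apply (ex_RInt_continuous (V := R_CompleteNormedModule)); intros x _.
apply (ex_derive_continuous (V := R_NormedModule)); auto_derive; auto.
Qed.

(** The integrand [g] is the derivative of [- cos x * sin x ^ (n + 1)], which vanishes at both
    endpoints. *)
Lemma wallis_rec (n : nat) : INR (n + 2) * wallis (n + 2) = INR (n + 1) * wallis n.
Proof.
pose (g := fun x => INR (n + 2) * sin x ^ (n + 2) - INR (n + 1) * sin x ^ n).
assert (H : is_RInt g 0 (PI / 2) 0).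
{ replace 0 with (minus (- (cos (PI / 2) * sin (PI / 2) ^ (n + 1)))
                        (- (cos 0 * sin 0 ^ (n + 1)))) at 2.
  2: { rewrite cos_PI2, sin_0, pow_i by lia; unfold minus, plus, opp; simpl; ring. }
  apply (is_RInt_derive (V := R_CompleteNormedModule)
          (fun x => - (cos x * sin x ^ (n + 1)))).
  - intros x _; unfold g; auto_derive; auto.
    replace (Init.Nat.pred (n + 1)) with n by lia.
    replace (n + 2)%nat with (S (S n)) by lia; replace (n + 1)%nat with (S n) by lia.
    assert (E := sin2_cos2 x); unfold Rsqr in E.
    rewrite (S_INR (S n)); simpl (_ ^ _).
    replace (1 * cos x) with (cos x) by ring.
    assert (E2 : cos x * cos x = 1 - sin x * sin x) by lra.
    transitivity (sin x * (sin x * sin x ^ n) - INR (S n) * sin x ^ n * (cos x * cos x)).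
      ring.
    rewrite E2; ring.
  - intros x _; unfold g.
    apply (ex_derive_continuous (V := R_NormedModule)); auto_derive; auto. }
apply (is_RInt_unique (V := R_CompleteNormedModule)) in H; unfold g in H.
rewrite (RInt_minus (V := R_CompleteNormedModule)) in H.
2, 3: apply (ex_RInt_scal (V := R_CompleteNormedModule)); apply ex_RInt_sin_pow.
rewrite !(RInt_scal (V := R_CompleteNormedModule)) in H by apply ex_RInt_sin_pow.
unfold minus, plus, opp, scal, mult in H; simpl in H; unfold mult in H; simpl in H.
unfold wallis; lra.
Qed.

Lemma wallis_decr (n : nat) : wallis (S n) <= wallis n.
Proof.
assert (P := PI_RGT_0).
apply RInt_le; try apply ex_RInt_sin_pow; [lra|].
intros x [x0 x1]; simpl.
assert (0 <= sin x) by (apply sin_ge_0; lra).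
assert (S1 := SIN_bound x).
assert (0 <= sin x ^ n) by (apply pow_le; lra).
nra.
Qed.

(** By [wallis_rec] the left-hand side does not depend on [n]; its value is computed at [n = 0]. *)
Lemma wallis_mul (n : nat) : INR (n + 1) * (wallis n * wallis (S n)) = PI / 2.
Proof.
induction n as [|n IH].
  unfold wallis; simpl (_ + _)%nat.
  rewrite (RInt_ext _ (fun _ => 1) 0 (PI / 2)) by (intros; reflexivity).
  rewrite (RInt_const (V := R_CompleteNormedModule)).
  rewrite (RInt_ext _ sin 0 (PI / 2)) by (intros; simpl; ring).
  replace (RInt sin 0 (PI / 2)) with 1.
    unfold scal; simpl; unfold mult; simpl; ring.
  symmetry; apply (is_RInt_unique (V := R_CompleteNormedModule)).
  replace 1 with (minus (- cos (PI / 2)) (- cos 0)).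
  2: { rewrite cos_PI2, cos_0; unfold minus, plus, opp; simpl; ring. }
  apply (is_RInt_derive (V := R_CompleteNormedModule) (fun x => - cos x)).
    intros x _; auto_derive; auto; ring.
  intros x _; apply (ex_derive_continuous (V := R_NormedModule)); auto_derive; auto.
rewrite <- IH; assert (H := wallis_rec n).
replace (n + 2)%nat with (S (S n)) in H by lia.
replace (S n + 1)%nat with (S (S n)) by lia.
transitivity (wallis (S n) * (INR (S (S n)) * wallis (S (S n)))).
  ring.
rewrite H; ring.
Qed.

(** The recurrence makes [c j] equal to C(2j, j) / 4^j, and [wallis (2 * j)] to [PI / 2 * c j]. By
    monotonicity it lies between its two neighbours, whose products with it are given by
    [wallis_mul]; this bounds its square. *)
Lemma central_binomial_bounds (c : nat -> R) : c O = 1 ->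
  (forall j, c (S j) = c j * (INR (2 * j + 1) / INR (2 * j + 2))) ->
  forall j, (1 <= j)%nat -> / (PI * (INR j + / 2)) <= c j ^ 2 <= / (PI * INR j).
Proof.
intros c0 cS j hj; assert (P := PI_RGT_0).
assert (W : forall j, wallis (2 * j) = PI / 2 * c j).
  clear j hj; intros j; induction j as [|j IH].
    unfold wallis; simpl (2 * _)%nat.
    rewrite (RInt_ext _ (fun _ => 1) 0 (PI / 2)) by (intros; reflexivity).
    rewrite (RInt_const (V := R_CompleteNormedModule)), c0.
    unfold scal; simpl; unfold mult; simpl; ring.
  assert (H := wallis_rec (2 * j)).
  replace (2 * S j)%nat with (2 * j + 2)%nat by lia.
  assert (INR (2 * j + 2) <> 0) by (apply not_0_INR; lia).
  apply (Rmult_eq_reg_l (INR (2 * j + 2))); auto.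
  rewrite H, IH, cS; field; auto.
assert (jpos : 1 <= INR j) by (apply (le_INR 1); auto).
assert (c_pos : forall j, 0 < c j).
  clear j hj jpos; intros j; induction j as [|j IH]; [lra|].
  rewrite cS; apply Rmult_lt_0_compat; auto.
  apply Rdiv_lt_0_compat; apply lt_0_INR; lia.
assert (M1 := wallis_mul (2 * j)); assert (D1 := wallis_decr (2 * j)).
assert (M2 := wallis_mul (2 * j - 1)); assert (D2 := wallis_decr (2 * j - 1)).
replace (S (2 * j - 1)) with (2 * j)%nat in M2, D2 by lia.
replace (2 * j - 1 + 1)%nat with (2 * j)%nat in M2 by lia.
rewrite plus_INR, mult_INR in M1; rewrite mult_INR in M2; simpl (INR 2) in *; simpl (INR 1) in *.
rewrite W in *; assert (Cj := c_pos j).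
set (w := wallis (S (2 * j))) in *; set (v := wallis (2 * j - 1)) in *.
set (x := INR j) in *; set (d := c j) in *.
assert (D1' : PI / 2 * d * w <= (PI / 2 * d) * (PI / 2 * d))
  by (apply Rmult_le_compat_l; [apply Rmult_le_pos; lra | lra]).
assert (D2' : v * (PI / 2 * d) >= (PI / 2 * d) * (PI / 2 * d))
  by (apply Rle_ge, Rmult_le_compat_r; [apply Rmult_le_pos; lra | lra]).
split.
- apply (Rmult_le_reg_l (PI * (x + / 2))); [apply Rmult_lt_0_compat; lra|].
  rewrite Rinv_r by (apply Rgt_not_eq; apply Rmult_lt_0_compat; lra).
  apply (Rmult_le_reg_l (PI / 2)); [lra|].
  rewrite Rmult_1_r, <- M1 at 1.
  replace (PI / 2 * (PI * (x + / 2) * d ^ 2)) with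
    ((2 * x + 1) * ((PI / 2 * d) * (PI / 2 * d))) by field.
  apply Rmult_le_compat_l; lra.
- apply (Rmult_le_reg_l (PI * x)); [apply Rmult_lt_0_compat; lra|].
  rewrite Rinv_r by (apply Rgt_not_eq; apply Rmult_lt_0_compat; lra).
  apply (Rmult_le_reg_l (PI / 2)); [lra|].
  rewrite Rmult_1_r.
  replace (PI / 2 * (PI * x * d ^ 2)) with
    ((1 + 1) * x * ((PI / 2 * d) * (PI / 2 * d))) by field.
  apply Rle_trans with (2 := Req_le _ _ M2).
  apply Rmult_le_compat_l; lra.
Qed.

End Wallis.

(** * Exact count of the pairs (a, b) *)

Module Counting.
Import all_boot.
Set Implicit Arguments. Unset Strict Implicit. Unset Printing Implicit Defensive.

(* [sqmult N m] is the sum of the squared multinomial coefficients [m! / (m_1! ... m_N!)],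
   that is, the number of pairs of words of length [m] with the same histogram. *)
Fixpoint sqmult (n m : nat) : nat :=
  if n is n'.+1 then \sum_(k < m.+1) 'C(m, k) ^ 2 * sqmult n' k else m == 0.

Lemma sum_subset_card (I : finType) (A : {set I}) (g : nat -> nat) :
  \sum_(S : {set I} | S \subset A) g #|S| = \sum_(k < #|A|.+1) 'C(#|A|, k) * g k.
Proof.
rewrite (partition_big (fun S : {set I} => inord #|S| : 'I_#|A|.+1) predT) //=.
apply: eq_bigr => k _.
rewrite -cards_draws -sum_nat_const; apply: congr_big => // S.
  rewrite !inE; case: (boolP (S \subset A)) => //= sSA.
  by rewrite -val_eqE /= inordK // ltnS subset_leq_card.
by move=> /andP[sSA /eqP <-]; rewrite inordK // ltnS subset_leq_card.
Qed.

Lemma sum_subset_setU (I : finType) (U D : {set I})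
    (F : {set I} -> {set I} -> nat) : [disjoint U & D] ->
  \sum_(S : {set I} | S \subset U :|: D) F (S :&: U) (S :&: D) =
  \sum_(S : {set I} | S \subset U) \sum_(S' : {set I} | S' \subset D) F S S'.
Proof.
move=> dUD; rewrite pair_big /=.
have UD0 : U :&: D = set0 by apply/eqP; rewrite setI_eq0.
rewrite (reindex_onto (fun p : {set I} * {set I} => p.1 :|: p.2)
  (fun S => (S :&: U, S :&: D))) /=; last first.
  by move=> S sS; rewrite -setIUr; apply/setIidPl.
have K (S S' : {set I}) : S \subset U -> S' \subset D ->
    (S :|: S') :&: U = S /\ (S :|: S') :&: D = S'.
  move=> sS sS'; rewrite !setIUl (setIidPl sS) (setIidPl sS'); split.
    suff -> : S' :&: U = set0 by rewrite setU0.
    by apply/eqP; rewrite -subset0 -UD0 setIC setIS.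
  suff -> : S :&: D = set0 by rewrite set0U.
  by apply/eqP; rewrite -subset0 -UD0 setSI.
apply: congr_big => // [[S S']|[S S']] /=.
  apply/andP/andP => [[_ /eqP[<- <-]]|[sS sS']]; first by rewrite !subsetIr.
  by have [-> ->] := K _ _ sS sS'; rewrite eqxx setUSS.
by move=> /andP[_ /eqP[-> ->]].
Qed.

(** * Colourings using every colour equally often on two sets *)

Section BalancedColorings.
Variables (I X : finType) (x0 : X).
Implicit Types (U D E : {set I}) (b : {ffun I -> X}).

Definition fiber b (c : X) : {set I} := [set y | b y == c].

(** [E] is meant for points free of the balance condition; points outside all three sets are pinned
    to [x0], so that partial colourings are counted as total functions. *)
Definition balanced (cs : seq X) U D E : {set {ffun I -> X}} :=
  [set b : {ffun I -> X} | [forall y, if y \in U :|: D :|: E then b y \in cs else b y == x0] &&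
           all (fun c => #|U :&: fiber b c| == #|D :&: fiber b c|) cs].

(* The points of [U :|: D :|: E] not coloured [c] form the set [S]. *)
Lemma card_balanced_cons c cs U D E : c \notin cs ->
  #|balanced (c :: cs) U D E| =
  \sum_(S : {set I} | (S \subset U :|: D :|: E) && (#|U :\: S| == #|D :\: S|))
    #|balanced cs (S :&: U) (S :&: D) (S :&: E)|.
Proof.
move=> c_cs; have [W defW] : {W | W = U :|: D :|: E} by exists (U :|: D :|: E).
have sUW : U \subset W by rewrite defW -setUA subsetUl.
have sDW : D \subset W by rewrite defW (setUC U) -setUA subsetUl.
rewrite /balanced -defW.
have UfE b (V : {set I}) : V \subset W -> V :\: (W :\: fiber b c) = V :&: fiber b c.
  move=> sV; apply/setP => y; rewrite !inE.
  case: (boolP (y \in V)) => [yV|_]; last by rewrite andbF.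
  by rewrite (subsetP sV _ yV) !andbT negbK.
rewrite -sum1_card (partition_big (fun b => W :\: fiber b c)
   (fun S => (S \subset W) && (#|U :\: S| == #|D :\: S|))) /=; last first.
  move=> b; rewrite inE /= => /andP[_ /andP[eqc _]].
  by rewrite subsetDl /= !UfE.
apply: eq_bigr => S /andP[sSW eqS]; rewrite -sum1_card.
(* [h] paints [W :\: S] with [c], and [h'] resets it to [x0]; this identifies the class of [S] with
   the balanced colourings of [S] by [cs]. *)
pose h b := [ffun y => if y \in W :\: S then c else b y] : {ffun I -> X}.
pose h' b := [ffun y => if y \in W :\: S then x0 else b y] : {ffun I -> X}.
have WSE : S :&: U :|: S :&: D :|: S :&: E = S.
  by rewrite -!setIUr -defW; apply/setIidPl.
rewrite (reindex_onto h h') /=; last first.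
  move=> b /andP[_ /eqP bS]; apply/ffunP => y; rewrite !ffunE.
  case: ifP => [|-> //]; rewrite -bS setDDr setDv set0U !inE.
  by move=> /andP[_ /eqP <-].
apply: eq_bigl => b; rewrite !inE WSE.
have fibE (V : {set I}) (c' : X) : V \subset W -> c' \in cs ->
    V :&: fiber (h b) c' = S :&: V :&: fiber b c'.
  move=> sV c'cs; apply/setP => y; rewrite !inE ffunE.
  case: (boolP (y \in V)) => [yV|_]; last by rewrite andbF.
  rewrite inE (subsetP sV _ yV) andbT /=; case: (y \in S) => //=.
  by apply/eqP => cc'; rewrite cc' c'cs in c_cs.
apply/idP/idP.
  move=> /andP[/andP[/andP[/forallP hW /andP[_ /allP hcs]] /eqP hS] /eqP hh'].
  apply/andP; split.
    apply/forallP => y; have := hW y; rewrite ffunE.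
    have := congr1 (fun f : {ffun I -> X} => f y) hh'; rewrite !ffunE.
    have := congr1 (fun A : {set I} => y \in A) hS; rewrite !inE ffunE inE.
    case: (boolP (y \in W)) => yW; case: (boolP (y \in S)) => yS //=.
    - by rewrite andbT => /negPf ->.
    - by move=> _ <-.
    - by rewrite (subsetP sSW) in yW.
  by apply/allP => c' c'cs; rewrite -!fibE ?hcs // inE c'cs orbT.
move=> /andP[/forallP hS /allP hcs].
have hbS : W :\: fiber (h b) c = S.
  apply/setP => y; rewrite !inE ffunE inE.
  have := hS y; case: (boolP (y \in S)) => yS /=.
    rewrite (subsetP sSW) // andbT => bcs.
    by apply: contraNneq c_cs => <-.
  by rewrite andbC; case: (y \in W) => //=; rewrite eqxx.
rewrite hbS eqxx andbT; apply/andP; split; last first.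
  apply/eqP/ffunP => y; rewrite !ffunE.
  have := hS y; rewrite !inE.
  by case: (boolP (y \in S)) => yS; case: (boolP (y \in W)) => yW //= /eqP ->.
apply/andP; split.
  apply/forallP => y; have := hS y; rewrite ffunE !inE.
  case: (boolP (y \in W)) => yW; case: (boolP (y \in S)) => yS //=.
  - by move=> ->; rewrite orbT.
  - by rewrite eqxx.
  - by rewrite (subsetP sSW) in yW.
apply/andP; split.
  by rewrite -!(UfE (h b)) // hbS.
by apply/allP => c' c'cs; rewrite !fibE ?hcs.
Qed.

(** Induction on the colours: [S] in [card_balanced_cons] splits into its traces on [U], [D] and
    [E]. Equal trace sizes on [U] and [D] give the squared binomials of [sqmult]; the traces on [E]
    add up to a power by the binomial theorem. *)
Lemma card_balanced cs U D E : uniq cs ->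
    [disjoint U & D] -> [disjoint U :|: D & E] -> #|U| = #|D| ->
  #|balanced cs U D E| = sqmult (size cs) #|U| * size cs ^ #|E|.
Proof.
elim: cs U D E => [|c cs IH] U D E.
  (* Without colours only the empty domain can be coloured, in accordance with [sqmult 0 0 = 1] and
     [0 ^ 0 = 1]. *)
  move=> _ dUD dE eUD /=.
  have -> : balanced [::] U D E =
      if (U :|: D :|: E) == set0 then [set [ffun=> x0]] else set0.
    case: eqP => [W0|/eqP/set0Pn[y yW]]; apply/setP => b; rewrite !inE andbT.
      apply/forallP/eqP => [h|-> y]; last by rewrite W0 inE ffunE.
      by apply/ffunP => y; have := h y; rewrite W0 inE ffunE => /eqP.
    by apply/negP => /forallP/(_ y); rewrite yW.
  rewrite !setU_eq0 -!cards_eq0 -eUD andbb.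
  by case: (#|U|) => [|u]; case: (#|E|) => [|e] /=; rewrite ?cards1 ?cards0 ?expn0 ?exp0n ?muln0.
move=> /= /andP[c_cs ucs] dUD dE eUD.
rewrite card_balanced_cons //.
(* [G] encodes the equality of traces as a factor 0 or 1, so that the three sums can run
   independently. *)
pose G k l j := (k == l) * (sqmult (size cs) k * size cs ^ j).
pose F (S S' : {set I}) := G #|S :&: U| #|S :&: D| #|S'|.
transitivity (\sum_(S : {set I} | S \subset U :|: D :|: E)
    F (S :&: (U :|: D)) (S :&: E)).
  rewrite big_mkcondr /=; apply: eq_bigr => S sS.
  have -> : (#|U :\: S| == #|D :\: S|) = (#|S :&: U| == #|S :&: D|).
    rewrite -(eqn_add2l #|U :&: S|) cardsID eUD -(cardsID S D) eqn_add2r.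
    by rewrite eq_sym ![S :&: _]setIC.
  rewrite /F /G -!setIA (setIidPr (subsetUl U D)) (setIidPr (subsetUr U D)).
  case: eqP => [eS|]; last by rewrite mul0n.
  rewrite IH ?mul1n //; first by rewrite (disjointW _ _ dUD) ?subsetIr.
  by rewrite (disjointW _ _ dE) ?subsetIr // -setIUr subsetIr.
rewrite sum_subset_setU //.
pose GE k l := \sum_(j < #|E|.+1) 'C(#|E|, j) * G k l j.
rewrite (eq_bigr (fun S : {set I} => GE #|S :&: U| #|S :&: D|)) => [|S _]; last first.
  exact: (sum_subset_card E (G _ _)).
rewrite (sum_subset_setU (fun S S' : {set I} => GE #|S| #|S'|)) //.
rewrite (eq_bigr (fun S : {set I} => \sum_(l < #|D|.+1) 'C(#|D|, l) * GE #|S| l)) => [|S _]; last first.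
  exact: (sum_subset_card D (GE _)).
rewrite (sum_subset_card U (fun k => \sum_(l < #|D|.+1) 'C(#|D|, l) * GE k l)).
rewrite -eUD big_distrl /=; apply: eq_bigr => k _.
rewrite (bigD1 k) //= big1 ?addn0 => [|l /negPf lk]; last first.
  rewrite /GE big1 ?muln0 // => j _.
  by rewrite /G -val_eqE /= eq_sym in lk *; rewrite lk mul0n muln0.
rewrite !mulnA mulnn -!mulnA; congr (_ * _); rewrite /GE.
rewrite -[(size cs).+1]add1n expnDn !big_distrr /=; apply: eq_bigr => j _.
by rewrite /G eqxx exp1n !mul1n; congr (_ * _); rewrite mulnCA.
Qed.
End BalancedColorings.

(** With [E] the complement of [U :|: D], every point is coloured and none is pinned. *)
Lemma card_balanced_all (I : finType) (N : nat) (U D : {set I}) : (0 < N)%N ->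
    [disjoint U & D] -> #|U| = #|D| ->
  #|[set b : {ffun I -> 'I_N} |
      [forall c, #|U :&: fiber b c| == #|D :&: fiber b c|]]| =
  sqmult N #|U| * N ^ (#|I| - #|U|.*2).
Proof.
case: N => // N _ dUD eUD.
have dE : [disjoint U :|: D & ~: (U :|: D)] by rewrite -setI_eq0 setICr.
have := card_balanced ord0 (enum_uniq 'I_N.+1) dUD dE eUD.
rewrite size_enum_ord.
have -> : #|~: (U :|: D)| = #|I| - #|U|.*2.
  rewrite cardsCs setCK cardsU; move: dUD; rewrite -setI_eq0 => /eqP ->.
  by rewrite cards0 subn0 -eUD addnn.
move=> <-; apply: eq_card => b; rewrite !inE setUCr.
apply/forallP/andP => [h|[_ /allP h] c]; last by rewrite h // mem_enum.
split; last by apply/allP => c _.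
by apply/forallP => y; rewrite inE mem_enum.
Qed.

(* Both sides of the multiset identity are recorded by the colour counts on
   [A] and on its shift; the points of [~: A] contribute the complementary counts. *)
Lemma perm_eq_shift (N p : nat) (a : {ffun 'I_p -> 'I_2}) (b : {ffun 'I_p -> 'I_N})
    (A := [set y | a y == 1 :> nat]) :
  perm_eq [seq (a y, b y) | y <- enum 'I_p] [seq (a y, b (ordS y)) | y <- enum 'I_p] =
  [forall c, #|A :&: fiber b c| == #|[set ordS y | y in A] :&: fiber b c|].
Proof.
have cntE (f : 'I_p -> 'I_2 * 'I_N) x :
    count_mem x [seq f y | y <- enum 'I_p] = #|[set y | f y == x]|.
  by rewrite count_map cardsE cardE -size_filter enumT.
have shiftE (V : {set 'I_p}) c :
    #|[set y in V | b (ordS y) == c]| = #|[set ordS y | y in V] :&: fiber b c|.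
  rewrite -(card_imset (mem [set y in V | b (ordS y) == c]) (@ordS_inj p)); apply: eq_card => z; rewrite !inE.
  apply/imsetP/andP => [[y /[!inE] /andP[yV bc] ->]|[/imsetP[y yV ->] bc]].
    by split => //; rewrite imset_f.
  by exists y => //; rewrite inE yV.
have shiftT : [set ordS y | y in [set: 'I_p]] = setT.
  by apply/setP => z; rewrite inE -[z]ord_predK imset_f.
have in1 c : [set y | (a y, b y) == (inord 1, c)] = A :&: fiber b c.
  by apply/setP => y; rewrite !inE xpair_eqE -val_eqE /= inordK.
have in1S c : [set y | (a y, b (ordS y)) == (inord 1, c)] = [set y in A | b (ordS y) == c].
  by apply/setP => y; rewrite !inE xpair_eqE -val_eqE /= inordK.
have a0 (i : 'I_2) : i != inord 1 -> forall j : 'I_2, (j == i) = (j != 1 :> nat).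
  rewrite -!val_eqE /= inordK // => i1 j; rewrite -val_eqE /=.
  by case: i i1 j => [[|[|i]] //= _] _ [[|[|j]]].
have in0 i c : i != inord 1 ->
    [set y | (a y, b y) == (i, c)] = fiber b c :\: A.
  by move=> i1; apply/setP => y; rewrite !inE xpair_eqE (a0 _ i1).
have in0S i c : i != inord 1 ->
    [set y | (a y, b (ordS y)) == (i, c)] = [set y | b (ordS y) == c] :\: A.
  by move=> i1; apply/setP => y; rewrite !inE xpair_eqE (a0 _ i1).
apply/idP/forallP => [/permP h c|h].
  by have := h (pred1 (inord 1, c)); rewrite /= !cntE in1 in1S shiftE => ->.
apply/allP => [[i c]] _; rewrite /= !cntE.
have [->|i1] := eqVneq i (inord 1); first by rewrite in1 in1S shiftE.
rewrite in0 // in0S // -(eqn_add2l #|fiber b c :&: A|) cardsID.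
rewrite setIC (eqP (h c)) -shiftE.
have -> : [set y in A | b (ordS y) == c] = [set y | b (ordS y) == c] :&: A.
  by apply/setP => y; rewrite !inE andbC.
rewrite cardsID.
have := shiftE setT c; rewrite shiftT setTI => <-.
by apply/eqP; apply: eq_card => y; rewrite !inE.
Qed.

Definition changes n (A : {set 'I_n.+1}) : {set 'I_n} :=
  [set j | (widen_ord (leqnSn n) j \in A) (+) (lift ord0 j \in A)].

(** The first letter and the changes determine a word, by induction along the positions; both sides
    have [2 ^ n.+1] elements. *)
Lemma changes_bij n :
  bijective (fun A : {set 'I_n.+1} => (ord0 \in A, changes A)).
Proof.
apply: inj_card_bij => [A B [e0 /setP eC]|]; last first.
  have cardE m : #|{: {set 'I_m}}| = 2 ^ m.
    by rewrite -cardsT -powersetT card_powerset cardsT card_ord.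
  by rewrite card_prod card_bool !cardE expnS.
apply/setP => -[i]; elim: i => [|i IH] lti.
  by rewrite (_ : Ordinal lti = ord0) //; apply: val_inj.
have lti' : i < n by [].
have := eC (Ordinal lti'); rewrite !inE.
rewrite (_ : widen_ord _ _ = Ordinal (ltnW lti)); last exact: val_inj.
rewrite (_ : lift _ _ = Ordinal lti); last exact: val_inj.
by rewrite IH => /addbI.
Qed.

(* The cyclic word has as many rises as falls; [changes A] omits only the possible
   change from the last position back to the first. *)
Lemma card_changes n (A : {set 'I_n.+1}) :
  uphalf #|changes A| = #|A :\: [set ordS y | y in A]|.
Proof.
set SA := [set _ | _ in _].
have SAE y : (y \in SA) = (ord_pred y \in A).
  by rewrite -[in LHS](ord_predK y) mem_imset //; exact: ordS_inj.
have cSA : #|SA| = #|A| by rewrite card_imset //; exact: ordS_inj.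
(* Cyclic changes are rises and falls, equally many since a set and its shift have the same size. *)
have cyc : #|[set y | (ord_pred y \in A) (+) (y \in A)]| = #|A :\: SA|.*2.
  rewrite -addnn -{2}(_ : #|SA :\: A| = #|A :\: SA|); last first.
    by apply/eqP; rewrite -(eqn_add2l #|A :&: SA|) cardsID setIC cardsID cSA.
  rewrite -[RHS]subn0 -(cards0 'I_n.+1) -(_ : (A :\: SA) :&: (SA :\: A) = set0).
    rewrite -cardsU; apply: eq_card => y; rewrite !inE SAE.
    by case: (y \in A) => //=; case: (ord_pred y \in A).
  by apply/setP => y; rewrite !inE; case: (y \in A); rewrite ?andbF.
have split_cyc : #|[set y | (ord_pred y \in A) (+) (y \in A)]| =
    ((ord_max \in A) (+) (ord0 \in A)) + #|changes A|.
  rewrite !cardsE -!sum1_card big_mkcond big_ord_recl [in RHS]big_mkcond /=; congr (_ + _).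
    rewrite -[in RHS](_ : ord_pred ord0 = ord_max); last first.
      by apply: val_inj; rewrite /= modn_small.
    by rewrite unfold_in /=; case: (_ (+) _).
  apply: eq_bigr => j _; rewrite !unfold_in /=.
  rewrite (_ : ord_pred _ = widen_ord (leqnSn n) j) //; apply: val_inj => /=.
  by rewrite modnDr modn_small ?add0n // ltnS ltnW.
(* The even cyclic number exceeds [#|changes A|] by 0 or 1, so rounding up half of the latter gives
   half of the former. *)
move: cyc; rewrite split_cyc; case: (_ (+) _) => e.
  by rewrite -[RHS]doubleK -e.
by move: e; rewrite add0n => ->; rewrite uphalf_double.
Qed.

(** For a fixed support [A] of [a], [card_balanced_all] counts the words [b]; sorting the supports
    by first letter and set of changes gives the factor 2 and the binomials. *)
Lemma delta_countE (N n : nat) : 0 < N ->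
  delta_count 2 N n.+1 =
  2 * \sum_(k < n.+1) 'C(n, k) * (sqmult N (uphalf k) * N ^ (n.+1 - (uphalf k).*2)).
Proof.
move=> N_gt0.
pose ind (A : {set 'I_n.+1}) := [ffun y => inord (y \in A)] : {ffun 'I_n.+1 -> 'I_2}.
pose G k := sqmult N (uphalf k) * N ^ (n.+1 - (uphalf k).*2).
transitivity (\sum_(A : {set 'I_n.+1}) G #|changes A|); last first.
  have [h' hK h'K] := changes_bij n.
  rewrite (reindex h'); last by exists (fun A : {set 'I_n.+1} => (ord0 \in A, changes A)) => ? _.
  transitivity (\sum_(p : bool * {set 'I_n}) G #|p.2|).
    by apply: eq_bigr => p _; rewrite -[p in RHS]h'K.
  rewrite -(pair_big xpredT xpredT (fun _ (C : {set 'I_n}) => G #|C|)) /=.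
  rewrite sum_nat_const card_bool; congr (_ * _).
  have := sum_subset_card [set: 'I_n] G; rewrite cardsT card_ord => <-.
  by apply: eq_bigl => C; rewrite subsetT.
rewrite /delta_count -sum1_card.
transitivity (\sum_(a : {ffun 'I_n.+1 -> 'I_2}) \sum_(b : {ffun 'I_n.+1 -> 'I_N} |
    perm_eq [seq (a y, b y) | y <- enum 'I_n.+1]
            [seq (a y, b (ordS y)) | y <- enum 'I_n.+1]) 1).
  by rewrite pair_big_dep /=; apply: eq_bigl => -[a b]; rewrite inE.
pose supp (a : {ffun 'I_n.+1 -> 'I_2}) := [set y | a y == 1 :> nat].
rewrite (reindex_onto ind supp) => [|a _]; last first.
  apply/ffunP => y; rewrite ffunE inE; apply: val_inj; rewrite /= inordK; last by case: (_ == _).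
  by case: (a y) => -[|[|]].
have suppK A : supp (ind A) = A.
  by apply/setP => y; rewrite inE ffunE inordK; case: (y \in A).
apply: eq_big => [A|A _]; first by rewrite suppK eqxx.
set SA := [set ordS y | y in A].
have cSA : #|SA| = #|A| by rewrite card_imset //; exact: ordS_inj.
have eAS : #|A :\: SA| = #|SA :\: A|.
  by apply/eqP; rewrite -(eqn_add2l #|A :&: SA|) cardsID setIC cardsID cSA.
have dAS : [disjoint A :\: SA & SA :\: A].
  rewrite -setI_eq0; apply/eqP/setP => y; rewrite !inE.
  by case: (y \in A); rewrite ?andbF.
rewrite /G card_changes -/SA.
have := card_balanced_all N_gt0 dAS eAS; rewrite card_ord => <-.
rewrite -sum1_card.
apply: eq_bigl => b; rewrite inE perm_eq_shift -/(supp _) suppK.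
apply: eq_forallb => c.
(* Adding the counts on [A :&: SA] turns the condition on the differences into the one on [A] and
   [SA]. *)
rewrite -[RHS](eqn_add2l #|A :&: SA :&: fiber b c|).
have cardD (B B' : {set 'I_n.+1}) :
   #|B :&: B' :&: fiber b c| + #|(B :\: B') :&: fiber b c| = #|B :&: fiber b c|.
  by rewrite -[RHS](cardsID B') setIAC -setIDAC.
by rewrite cardD setIC -/SA [A :&: SA]setIC cardD.
Qed.

End Counting.

Module Asymptotics.
Import all_boot all_order all_algebra ring lra zify.
Import all_classical reals topology normedtype sequences realfun exp.
Import Counting.
Set Implicit Arguments. Unset Strict Implicit. Unset Printing Implicit Defensive.
Import Order.TTheory GRing.Theory Num.Theory numFieldNormedType.Exports.
Local Open Scope classical_set_scope.
Local Open Scope ring_scope.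

(** * Exponential concentration of the binomial law *)

Section Concentration.
Context {R : realType}.
Implicit Types (s x t C D : R) (f : nat -> R) (w : nat -> nat -> R).

Definition binom_weight s n k : R := 'C(n, k)%:R * s ^+ k * (1 - s) ^+ (n - k).

Lemma binom_weight_ge0 s n k : 0 <= s <= 1 -> 0 <= binom_weight s n k.
Proof. by move=> /andP[s0 s1]; rewrite !mulr_ge0 ?exprn_ge0 ?subr_ge0. Qed.

Lemma binom_weight_gen s x n :
  \sum_(k < n.+1) binom_weight s n k * x ^+ k = (1 - s + s * x) ^+ n.
Proof.
rewrite exprDn; apply: eq_bigr => k _.
by rewrite /binom_weight exprMn -mulr_natl; ring.
Qed.

Lemma sum_binom_weight s n : \sum_(k < n.+1) binom_weight s n k = 1.
Proof.
have := binom_weight_gen s 1 n.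
rewrite mulr1 subrK expr1n => <-.
by apply: eq_bigr => k _; rewrite expr1n mulr1.
Qed.

Lemma binom_weight_le1 s n (k : 'I_n.+1) : 0 <= s <= 1 -> binom_weight s n k <= 1.
Proof.
move=> s01; rewrite -(sum_binom_weight s n) (bigD1 k) //= lerDl.
by apply: sumr_ge0 => i _; exact: binom_weight_ge0.
Qed.

(** Compare both sides with 1/(1 - x): (1 + x + 2x^2)(1 - x) - 1 equals x^2 (1 - 2x). *)
Lemma expR_le_quadratic x : x <= 2^-1 -> expR x <= 1 + x + 2 * x ^+ 2.
Proof.
move=> x2; have h := expR_ge1Dx (- x).
have x1 : 0 < 1 - x by lra.
have ex : expR x <= (1 - x)^-1.
  by rewrite -[x in expR x]opprK expRN lef_pV2 ?posrE ?expR_gt0.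
apply: le_trans ex _; rewrite -div1r ler_pdivrMr //.
suff : 0 <= x ^+ 2 * (1 - 2 * x) by nra.
by rewrite mulr_ge0 ?sqr_ge0 //; lra.
Qed.

(** The sum is the [n]-th power of a one-step average. After [expR_le_quadratic] its linear terms in
    [t] cancel and the quadratic ones sum to 2t^2 s(1 - s). *)
Lemma binom_mgf_le s t n : 0 <= s <= 1 -> `|t| <= 2^-1 ->
  \sum_(k < n.+1) binom_weight s n k * expR (t * (k%:R - s * n%:R)) <=
  expR (2 * t ^+ 2 * n%:R).
Proof.
move=> /andP[s0 s1]; rewrite ler_norml => /andP[t1 t2].
have -> : \sum_(k < n.+1) binom_weight s n k * expR (t * (k%:R - s * n%:R)) =
    ((1 - s) * expR (- (t * s)) + s * expR (t * (1 - s))) ^+ n.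
  rewrite [t * (1 - s)](_ : _ = - (t * s) + t); last by ring.
  rewrite expRD (_ : _ + _ = expR (- (t * s)) * (1 - s + s * expR t)); last by ring.
  rewrite exprMn -binom_weight_gen big_distrr /=; apply: eq_bigr => k _.
  rewrite -!expRM_natl mulrCA; congr (_ * _); rewrite -expRD; congr expR.
  by ring.
rewrite [2 * t ^+ 2 * _]mulrC expRM_natl; apply: lerXn2r; rewrite ?nnegrE ?expR_ge0 //.
  by rewrite addr_ge0 // mulr_ge0 ?expR_ge0 ?subr_ge0.
apply: le_trans (expR_ge1Dx _).
have e1 : expR (- (t * s)) <= 1 - t * s + 2 * (t * s) ^+ 2.
  by apply: le_trans (expR_le_quadratic _) _; [nra|rewrite sqrrN].
have e2 : expR (t * (1 - s)) <= 1 + t * (1 - s) + 2 * (t * (1 - s)) ^+ 2.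
  by apply: expR_le_quadratic; nra.
have := lerD (ler_wpM2l (_ : 0 <= 1 - s) e1) (ler_wpM2l s0 e2).
rewrite subr_ge0 => /(_ s1) h; apply: le_trans h _.
suff : 0 <= t ^+ 2 * (1 - s * (1 - s)) by nra.
by rewrite mulr_ge0 ?sqr_ge0 //; nra.
Qed.

Lemma binom_tail_le s e n : 0 <= s <= 1 -> 0 < e <= 1 ->
  \sum_(k < n.+1 | e * n%:R < `|k%:R - s * n%:R|) binom_weight s n k <=
  2 * expR (- (e ^+ 2 / 8 * n%:R)).
Proof.
(* Chernoff's bound with [t] and [- t], one for each tail; this [t] minimises 2t^2 - te, with
   minimum -e^2/8. *)
move=> s01 /andP[e0 e1]; set t := e / 4.
have t2 : `|t| <= 2^-1 by rewrite ger0_norm /t; lra.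
have m1 := binom_mgf_le n s01 t2.
have m2 : \sum_(k < n.+1) binom_weight s n k * expR (- t * (k%:R - s * n%:R)) <=
    expR (2 * t ^+ 2 * n%:R).
  by rewrite -(sqrrN t); apply: binom_mgf_le; rewrite ?normrN.
rewrite (_ : - _ = 2 * t ^+ 2 * n%:R - t * e * n%:R); last by rewrite /t; field.
rewrite expRD mulrA expRN -ler_pdivrMr ?invr_gt0 ?expR_gt0 // invrK.
rewrite mulr_natl mulr2n; apply: le_trans (lerD m1 m2).
rewrite -big_split /= mulr_suml big_mkcond /=; apply: ler_sum => k _.
have w0 : 0 <= binom_weight s n k by exact: binom_weight_ge0.
rewrite -mulrDr; case: ifP => [|_]; last by rewrite mulr_ge0 ?addr_ge0 ?expR_ge0.
move=> far; apply: ler_wpM2l => //.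
have t0 : 0 < t by rewrite /t; lra.
move: far; rewrite ltr_normr => /orP[far|far].
  rewrite -[leLHS]addr0 lerD ?expR_ge0 // ler_expR -mulrA ler_pM2l //.
  exact: ltW.
rewrite -[leLHS]add0r lerD ?expR_ge0 // ler_expR -mulrA mulNr -mulrN ler_pM2l //.
exact: ltW.
Qed.

Lemma cvg_sqrt_natV : (Num.sqrt n%:R)^-1 @[n --> \oo] --> (0 : R).
Proof.
apply/cvgrPdist_le => e e0; near=> n.
rewrite sub0r normrN ger0_norm ?invr_ge0 ?sqrtr_ge0 //.
have n0 : 0 < n%:R :> R by rewrite ltr0n; near: n; exists 1%N.
rewrite -[e]invrK lef_pV2 ?posrE ?invr_gt0 ?sqrtr_gt0 //.
rewrite -(ger0_norm (ltW (_ : 0 < e^-1))) ?invr_gt0 // -sqrtr_sqr ler_sqrt ?ltW //.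
near: n; exact: nbhs_infty_gtr.
Unshelve. all: by end_near. Qed.

(** For exponent 1, [expR (b * n) >= b * n] leaves at most 1/(b sqrt(n)). This dominates exponent 0,
    and exponent [m.+1] is a power of the case of rate [a / m.+1]. *)
Lemma cvg_expRN_sqrt a m : 0 < a ->
  expR (- (a * n%:R)) * Num.sqrt n%:R ^+ m @[n --> \oo] --> (0 : R).
Proof.
move=> a0.
have sub b : 0 < b -> expR (- (b * n%:R)) * Num.sqrt n%:R @[n --> \oo] --> (0 : R).
  move=> b0.
  apply: (@squeeze_cvgr _ _ _ _ (fun=> 0) (fun n => b^-1 * (Num.sqrt n%:R)^-1)).
  - near=> n; rewrite mulr_ge0 ?expR_ge0 ?sqrtr_ge0 //=.
    have n0 : 0 < n%:R :> R by rewrite ltr0n; near: n; exists 1%N.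
    have q0 : 0 < Num.sqrt n%:R :> R by rewrite sqrtr_gt0.
    rewrite -ler_pdivlMr // -mulrA -invfM -expr2 sqr_sqrtr ?ler0n //.
    rewrite expRN -invfM lef_pV2 ?posrE ?expR_gt0 ?mulr_gt0 //.
    by apply: le_trans (expR_ge1Dx _); rewrite lerDr.
  - exact: cvg_cst.
  - by rewrite -[0](mulr0 b^-1); exact: cvgM (cvg_cst _) cvg_sqrt_natV.
case: m => [|m].
  apply: (@squeeze_cvgr _ _ _ _ (fun=> 0) (fun n => expR (- (a * n%:R)) * Num.sqrt n%:R)).
  - near=> n; rewrite expr0 mulr1 expR_ge0 ler_peMr ?expR_ge0 //.
    have n1 : 1 <= n%:R :> R by rewrite ler1n; near: n; exists 1%N.
    by rewrite -[leLHS]sqrtr1 ler_wsqrtr.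
  - exact: cvg_cst.
  - exact: sub.
have am : 0 < a / m.+1%:R by rewrite divr_gt0 ?ltr0n.
rewrite -[0](expr0n R m.+1).
rewrite (_ : (fun n => _) = (fun n => (expR (- (a / m.+1%:R * n%:R)) * Num.sqrt n%:R) ^+ m.+1)).
  apply: (@continuous_cvg _ _ _ _ _ _ (fun x => x ^+ m.+1)); last exact: sub.
  exact: exprn_continuous.
apply/funext => n; rewrite exprMn -expRM_natl; congr (expR _ * _).
by rewrite mulrN !mulrA [m.+1%:R * _]mulrC mulfK // pnatr_eq0.
Unshelve. all: by end_near. Qed.
End Concentration.

(** * Averages of functions that follow a power law *)

Section PowerLaws.
Context {R : realType}.
Implicit Types (s x t C D : R) (f : nat -> R) (w : nat -> nat -> R).

Lemma cvg_sqrt_expr (T : Type) (F : set_system T) {FF : Filter F} (u : T -> R) (a : R) d :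
  u @ F --> a -> Num.sqrt (u x) ^+ d @[x --> F] --> Num.sqrt a ^+ d.
Proof.
move=> ua.
apply: (@continuous_cvg _ _ _ _ _ _ (fun x : R => x ^+ d)).
  exact: exprn_continuous.
by apply: continuous_cvg => //; exact: sqrt_continuous.
Qed.

(** [f k * Num.sqrt n%:R ^+ d] is the quotient of [f k * Num.sqrt k%:R ^+ d] by sqrt(k/n)^d, and x /
    sqrt(y)^d is continuous at (C, s). *)
Lemma power_law_window f d C s (c : R) : 0 < s -> 0 < c ->
    f k * Num.sqrt k%:R ^+ d @[k --> \oo] --> C ->
  exists2 e : R, 0 < e <= 1 & \forall n \near \oo, forall k,
    `|k%:R - s * n%:R| <= e * n%:R ->
    `|f k * Num.sqrt n%:R ^+ d - C / Num.sqrt s ^+ d| <= c.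
Proof.
move=> s0 c0 fC.
have h : p.1 / Num.sqrt p.2 ^+ d @[p --> (C, s)] --> C / Num.sqrt s ^+ d.
  apply: cvgM; first exact: cvg_fst.
  apply: cvgV; first by rewrite expf_neq0 // gt_eqF // sqrtr_gt0.
  by apply: cvg_sqrt_expr; exact: cvg_snd.
have [[A B] /= [/nbhs_ballP[r1 /= r10 sA] /nbhs_ballP[r2 /= r20 sB]] sub] :=
  (cvgrPdist_le _ _).1 h _ c0.
(* Below [r2], [e] keeps k/n near [s]; below [s], it makes k >= (s - e)n grow with [n]; the cap 1
   suits [binom_tail_le]. *)
set e := Num.min (Num.min r2 s / 2) 1.
have m0 : 0 < Num.min r2 s by rewrite lt_min r20 s0.
have e0 : 0 < e by rewrite lt_min ltr01 divr_gt0.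
have em : e < Num.min r2 s by rewrite gt_min ltr_pdivrMr // ltr_pMr // ltr1n.
move: (em); rewrite lt_min => /andP[er2 es].
exists e; first by rewrite e0 ge_min lexx orbT.
have [K _ hK] := (cvgrPdist_lt _ _).1 fC _ r10.
near=> n => k kn.
have n0 : 0 < n%:R :> R by rewrite ltr0n; near: n; exists 1%N.
have nK : K%:R / (s - e) <= n%:R by near: n; exact: nbhs_infty_ger.
have se : 0 < s - e by rewrite subr_gt0.
have kl : (s - e) * n%:R <= k%:R by move: kn; rewrite ler_norml => /andP[kn _]; lra.
have k0 : 0 < k%:R :> R by apply: lt_le_trans kl; rewrite mulr_gt0.
have kK : (K <= k)%N.
  rewrite -(ler_nat R); apply: le_trans kl.
  by rewrite -ler_pdivrMl // mulrC.
have xs : `|k%:R / n%:R - s| < r2.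
  apply: le_lt_trans er2.
  rewrite -(ler_pM2r n0) -[X in _ * X <= _](ger0_norm (ltW n0)) -normrM mulrBl.
  by rewrite divfK ?gt_eqF.
have := sub (f k * Num.sqrt k%:R ^+ d, k%:R / n%:R).
have gA : A (f k * Num.sqrt k%:R ^+ d) by apply: sA; exact: hK.
have xB : B (k%:R / n%:R) by apply: sB; rewrite /ball /= distrC.
move=> /(_ (conj gA xB)) /=.
rewrite distrC sqrtrM ?ler0n // sqrtrV ?ler0n // exprMn exprVn.
suff -> : f k * Num.sqrt k%:R ^+ d / (Num.sqrt k%:R ^+ d / Num.sqrt n%:R ^+ d) =
    f k * Num.sqrt n%:R ^+ d by [].
by field; rewrite !expf_neq0 // gt_eqF // sqrtr_gt0.
Unshelve. all: by end_near. Qed.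

Lemma power_law_bounded f d C :
  f k * Num.sqrt k%:R ^+ d @[k --> \oo] --> C -> exists2 B, 0 <= B & forall k, `|f k| <= B.
Proof.
move=> fC; have [M [_ hM]] : bounded_fun (fun k => f k * Num.sqrt k%:R ^+ d).
  by apply: cvg_seq_bounded; apply/cvg_ex; exists C.
pose B := `|M| + 1; have B0 : 0 <= B by rewrite addr_ge0.
have hB : forall k, `|f k * Num.sqrt k%:R ^+ d| <= B.
  by move=> k; apply: (hM B) => //; rewrite (le_lt_trans (ler_norm M)) // ltrDl.
(* At [k = 0] the factor [Num.sqrt 0 ^+ d] may vanish, so [f 0] is bounded separately. *)
exists (B + `|f 0%N|) => [|[|k]]; first by rewrite addr_ge0.
  by rewrite lerDr.
apply: le_trans (_ : B <= _); last by rewrite lerDl.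
apply: le_trans (hB k.+1); rewrite normrM ler_peMr // ger0_norm ?exprn_ge0 ?sqrtr_ge0 //.
by rewrite exprn_ege1 // -[leLHS]sqrtr1 ler_wsqrtr // ler1n.
Qed.

(* The weights concentrate around [k = s n] with exponentially small tails, so
   polynomial normalizations do not see the values of [f] far from [s n]. *)
Lemma cvg_average s w f d e C D : 0 < s < 1 ->
    (forall n (k : 'I_n.+1), 0 <= w n k <= binom_weight s n k) ->
    f k * Num.sqrt k%:R ^+ d @[k --> \oo] --> C ->
    (\sum_(k < n.+1) w n k) * Num.sqrt n%:R ^+ e @[n --> \oo] --> D ->
  (\sum_(k < n.+1) w n k * f k) * Num.sqrt n%:R ^+ (d + e) @[n --> \oo] -->
    C / Num.sqrt s ^+ d * D.
Proof.
move=> /andP[s0 s1] wb fC wD; set L := C / _.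
have s01 : 0 <= s <= 1 by rewrite !ltW.
suff h0 : (\sum_(k < n.+1) w n k * (f k * Num.sqrt n%:R ^+ d - L)) * Num.sqrt n%:R ^+ e
    @[n --> \oo] --> (0 : R).
  have h1 := cvgD h0 (cvgM (cvg_cst L) wD); rewrite add0r in h1.
  apply: cvg_trans _ (h1 _ _ _); apply: near_eq_cvg; near=> n => /=.
  rewrite !fctE /= (eq_bigr (fun k : 'I_n.+1 => w n k * f k * Num.sqrt n%:R ^+ d - w n k * L)).
    rewrite sumrB -!mulr_suml exprD; ring.
  by move=> k _; ring.
apply/cvgrPdist_le => c c0.
(* [M] bounds the normalized mass for large [n], so that the window contributes at most c/2. *)
pose M := `|D| + 1.
have M0 : 0 < M by rewrite ltr_wpDl.
have c'0 : 0 < c / (2 * M) by rewrite divr_gt0 // mulr_gt0.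
have [r r01 hwin] := power_law_window s0 c'0 fC.
have [B B0 fB] := power_law_bounded fC.
pose a : R := r ^+ 2 / 8.
have a0 : 0 < a by rewrite divr_gt0 // exprn_gt0 //; case/andP: r01.
(* Off the window the deviation is at most B sqrt(n)^d + |L|, against a tail weight of at most 2
   exp(-an). *)
have tail0 : 2 * B * (expR (- (a * n%:R)) * Num.sqrt n%:R ^+ (d + e)) +
    2 * `|L| * (expR (- (a * n%:R)) * Num.sqrt n%:R ^+ e) @[n --> \oo] --> (0 : R).
  rewrite -[0](_ : 2 * B * 0 + 2 * `|L| * 0 = 0); last by rewrite !mulr0 addr0.
  by apply: cvgD; (apply: cvgM; [exact: cvg_cst|exact: cvg_expRN_sqrt]).
have c20 : 0 < c / 2 by rewrite divr_gt0.
near=> n.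
have win : forall k : nat, `|k%:R - s * n%:R| <= r * n%:R ->
    `|f k * Num.sqrt n%:R ^+ d - L| <= c / (2 * M) by near: n; exact: hwin.
have tl : `|0 - (2 * B * (expR (- (a * n%:R)) * Num.sqrt n%:R ^+ (d + e)) +
    2 * `|L| * (expR (- (a * n%:R)) * Num.sqrt n%:R ^+ e))| <= c / 2.
  by near: n; exact: (cvgrPdist_le _ _).1 tail0 _ c20.
have mass : `|D - (\sum_(k < n.+1) w n k) * Num.sqrt n%:R ^+ e| <= 1.
  by near: n; exact: (cvgrPdist_le _ _).1 wD _ ltr01.
rewrite sub0r normrN normrM [`|_ ^+ e|]ger0_norm ?exprn_ge0 ?sqrtr_ge0 //.
set q := Num.sqrt n%:R in tl mass win *.
have q0 m : 0 <= q ^+ m by rewrite exprn_ge0 ?sqrtr_ge0.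
have w0 (k : 'I_n.+1) : 0 <= w n k by have /andP[] := wb n k.
pose T := \sum_(k < n.+1 | r * n%:R < `|k%:R - s * n%:R|) w n k.
have TB : T <= 2 * expR (- (a * n%:R)).
  apply: le_trans (binom_tail_le n s01 r01); apply: ler_sum => k _.
  by have /andP[] := wb n k.
have sumle : `|\sum_(k < n.+1) w n k * (f k * q ^+ d - L)| <=
    c / (2 * M) * \sum_(k < n.+1) w n k + (B * q ^+ d + `|L|) * T.
  apply: le_trans (ler_norm_sum _ _ _) _.
  rewrite /T [X in _ + _ * X]big_mkcond /= !mulr_sumr -big_split /=.
  apply: ler_sum => k _; rewrite normrM ger0_norm //.
  case: ltP => [_|kn].
    apply: le_trans (_ : w n k * (B * q ^+ d + `|L|) <= _); last first.
      by rewrite [leLHS]mulrC lerDr mulr_ge0 // ltW.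
    apply: ler_wpM2l => //; apply: le_trans (ler_normB _ _) _.
    by rewrite lerD2r normrM [`|q ^+ d|]ger0_norm // ler_wpM2r.
  by rewrite mulr0 addr0 mulrC ler_wpM2r // win.
apply: le_trans (ler_wpM2r (q0 e) sumle) _.
have massM : (\sum_(k < n.+1) w n k) * q ^+ e <= M.
  move: mass; rewrite ler_norml => /andP[h _].
  have := ler_norm D; rewrite /M; lra.
have tailM : (B * q ^+ d + `|L|) * T * q ^+ e <= c / 2.
  apply: le_trans (_ : (B * q ^+ d + `|L|) * (2 * expR (- (a * n%:R))) * q ^+ e <= _).
    by rewrite ler_wpM2r // ler_wpM2l // addr_ge0 // mulr_ge0.
  apply: le_trans tl; rewrite sub0r normrN; apply: le_trans (ler_norm _).
  by rewrite exprD le_eqVlt; apply/orP; left; apply/eqP; ring.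
have : c / (2 * M) * ((\sum_(k < n.+1) w n k) * q ^+ e) <= c / (2 * M) * M.
  by rewrite ler_pM2l.
have -> : c / (2 * M) * M = c / 2 by field; rewrite gt_eqF.
by rewrite mulrDl -mulrA; lra.
Unshelve. all: by end_near. Qed.

(** Since |2h(k) - k| <= 1, k/h(k) tends to 2; this covers both [half] and [uphalf]. *)
Lemma cvg_power_law_half f d C (h : nat -> nat) :
    (forall k, (k <= (h k).*2.+1)%N && ((h k).*2 <= k.+1)%N) ->
    f k * Num.sqrt k%:R ^+ d @[k --> \oo] --> C ->
  f (h k) * Num.sqrt k%:R ^+ d @[k --> \oo] --> C * Num.sqrt 2 ^+ d.
Proof.
move=> hh fC.
have hoo : h @ \oo --> \oo.
  move=> A [m _ mA]; exists m.*2.+2 => // k /= mk; apply: mA => /=.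
  have /andP[kh _] := hh k; rewrite -leq_double.
  by have := leq_trans mk kh; rewrite ltnS => /ltnW.
have h_gt0 : \forall k \near \oo, 0 < (h k)%:R :> R.
  by apply: (hoo [set m | 0 < m%:R :> R]); exact: nbhs_infty_gtr.
have ratio : k%:R / (h k)%:R @[k --> \oo] --> (2 : R).
  apply/cvgrPdist_le => e e0; near=> k.
  have hk0 : 0 < (h k)%:R :> R by near: k.
  have hke : e^-1 <= (h k)%:R.
    by near: k; apply: (hoo [set m | e^-1 <= m%:R]); exact: nbhs_infty_ger.
  have he1 : 1 <= e * (h k)%:R by rewrite -ler_pdivrMl // mulr1.
  have -> : 2 - k%:R / (h k)%:R = (2 * (h k)%:R - k%:R) / (h k)%:R :> R.
    by field; rewrite gt_eqF.
  rewrite normrM normfV (ger0_norm (ltW hk0)) ler_pdivrMr //; apply: le_trans he1.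
  have /andP[] := hh k; rewrite -!(ler_nat R) -!natr1 -!mul2n !natrM => h1 h2.
  by rewrite ler_norml; apply/andP; split; lra.
have h1 := cvgM (cvg_comp _ _ hoo fC) (cvg_sqrt_expr (d := d) ratio).
apply: cvg_trans _ (h1 _ _); apply: near_eq_cvg; near=> k => /=.
have hk0 : 0 < (h k)%:R :> R by near: k.
rewrite sqrtrM ?ler0n // sqrtrV ?ler0n // exprMn exprVn /=.
by field; rewrite !expf_neq0 // gt_eqF // sqrtr_gt0.
Unshelve. all: by end_near. Qed.
End PowerLaws.

(** * Asymptotics of the collision probabilities and of the density *)

Section CollisionProbability.
Context {R : realType}.
Implicit Types (s x t C D : R) (f : nat -> R) (w : nat -> nat -> R).

Lemma expr_linear_poly (a b : R) n :
  (a%:P + b%:P * 'X) ^+ n = \poly_(k < n.+1) ('C(n, k)%:R * b ^+ k * a ^+ (n - k)).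
Proof.
rewrite exprDn poly_def; apply: eq_bigr => k _.
rewrite exprMn -!polyC_exp mulrA -polyCM mul_polyC -scaler_nat scalerA.
by congr (_ *: _); ring.
Qed.

Lemma coef_expr_1DXsq k :
  ((1 + 'X^2) ^+ k : {poly R})`_k = if odd k then 0 else 'C(k, k./2)%:R.
Proof.
rewrite exprDn coef_sum.
under eq_bigr => i _ do
  rewrite expr1n mul1r -exprM coefMn coefXn mulrb eq_sym.
case: ifP => ok.
  rewrite big1 // => i _; case: eqP => [e|_]; last by rewrite mul0rn.
  by have := congr1 odd e; rewrite mul2n odd_double ok.
have kk : k./2.*2 = k by rewrite even_halfK ?ok.
have ltk : (k./2 < k.+1)%N by rewrite ltnS -[X in (_ <= X)%N]kk -addnn leq_addr.
rewrite (bigD1 (Ordinal ltk)) //= mul2n kk eqxx big1 ?addr0 // => i ik.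
case: eqP => [e|_]; last by rewrite mul0rn.
by case/eqP: ik; apply: val_inj; have := congr1 half e; rewrite mul2n doubleK.
Qed.

(* Compare coefficients of ['X^n] in
   [(1 - q + q X)^n (q + (1 - q) X)^n = ((1 - s) X + (s / 2) (1 + X^2))^n]. *)
Lemma sum_binom_weight_sq (q : R) n (s := 2 * q * (1 - q)) :
  \sum_(k < n.+1) binom_weight q n k ^+ 2 =
  \sum_(k < n.+1) (if odd k then 0 else binom_weight s n k) *
    ('C(k./2.*2, k./2)%:R / 4 ^+ k./2).
Proof.
have pE : ((1 - q)%:P + q%:P * 'X) * (q%:P + (1 - q)%:P * 'X) =
    (1 - s)%:P * 'X + (s / 2)%:P * (1 + 'X^2).
  have -> : s / 2 = q * (1 - q) by rewrite /s; field.
  have -> : 1 - s = (1 - q) * (1 - q) + q * q by rewrite /s; ring.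
  by rewrite polyCD !polyCM; ring.
have := congr1 (fun p : {poly R} => (p ^+ n)`_n) pE; rewrite exprMn /=.
rewrite (expr_linear_poly (1 - q)) (expr_linear_poly q) coefM.
(* Exchanging [q] and [1 - q] reverses the coefficients, so the middle coefficient of the product is
   a sum of squares. *)
rewrite (eq_bigr (fun k : 'I_n.+1 => binom_weight q n k ^+ 2)) => [->|k _]; last first.
  rewrite !coef_poly ltn_ord ltnS leq_subr /binom_weight subKn -1?ltnS //.
  by rewrite bin_sub -1?ltnS //; ring.
rewrite exprDn coef_sum; apply: eq_bigr => k _.
rewrite coefMn !exprMn -!polyC_exp -mulrA coefCM mulrCA coefCM mulrC.
have kn : (k <= n)%N by rewrite -ltnS.
rewrite coefXnM ltnNge leq_subr /= subKn // coef_expr_1DXsq /binom_weight.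
case: (boolP (odd k)) => ok.
  by rewrite mulr0 !mul0r mul0rn.
have kk : k./2.*2 = k by rewrite even_halfK.
have e4 : 2 ^+ k = 4 ^+ k./2 :> R by rewrite -{1}kk -mul2n exprM -natrX.
by rewrite -[LHS]mulr_natl kk expr_div_n e4; field; rewrite expf_neq0 ?pnatr_eq0.
Qed.

(** Averaging the generating function at 1 and -1 isolates the even indices and gives (1 + (1 -
    2s)^n)/2. *)
Lemma cvg_even_binom_mass s : 0 < s < 1 ->
  \sum_(k < n.+1) (if odd k then 0 else binom_weight s n k) @[n --> \oo] --> (2^-1 : R).
Proof.
move=> /andP[s0 s1].
have evenE n : \sum_(k < n.+1) (if odd k then 0 else binom_weight s n k) =
    2^-1 * (1 + (1 - 2 * s) ^+ n).
  rewrite -[X in _ * (X + _)](sum_binom_weight s n) (_ : 1 - 2 * s = 1 - s + s * -1); last by ring.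
  rewrite -binom_weight_gen -big_split big_distrr /=; apply: eq_bigr => k _.
  by rewrite -signr_odd; case: odd => /=; rewrite ?expr0 ?expr1; field.
under eq_cvg => n do rewrite evenE.
suff : 2^-1 * (1 + (1 - 2 * s) ^+ n) @[n --> \oo] --> 2^-1 * (1 + 0 : R).
  by rewrite addr0 mulr1.
apply: cvgM; first exact: cvg_cst.
apply: cvgD; first exact: cvg_cst.
by apply: cvg_expr; rewrite ltr_norml; apply/andP; split; lra.
Qed.

(* The probability that two uniform words of length [m] over [N] letters have the
   same histogram. *)
Definition collision N m : R := (sqmult N m)%:R / N%:R ^+ m ^+ 2.

Lemma collision1 m : collision 1 m = 1.
Proof.
rewrite /collision expr1n expr1n divr1 /= big_ord_recl big1 ?addn0 => [|k _].
  by rewrite bin0.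
by rewrite muln0.
Qed.

(** The weight is C(m, k) n^k / (n+1)^m, so its square carries both normalizations. *)
Lemma collisionS n m : (0 < n)%N -> collision n.+1 m =
  \sum_(k < m.+1) binom_weight (n%:R / n.+1%:R) m k ^+ 2 * collision n k.
Proof.
move=> n0; rewrite /collision [sqmult _ _]/= natr_sum mulr_suml; apply: eq_bigr => k _.
have nn0 : n%:R != 0 :> R by rewrite pnatr_eq0 -lt0n.
have nS0 : n.+1%:R != 0 :> R by rewrite pnatr_eq0.
have -> : binom_weight (n%:R / n.+1%:R) m k =
    'C(m, k)%:R * n%:R ^+ k / n.+1%:R ^+ m :> R.
  rewrite /binom_weight.
  have -> : 1 - n%:R / n.+1%:R = n.+1%:R^-1 :> R.
    by apply: (mulIf nS0); rewrite mulrBl divfK // mulVf // -natr1; ring.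
  rewrite expr_div_n exprVn.
  have -> : n.+1%:R ^+ m = n.+1%:R ^+ k * n.+1%:R ^+ (m - k) :> R.
    by rewrite -exprD subnKC -1?ltnS.
  by field; rewrite !expf_neq0.
rewrite natrM natrX.
by field; rewrite !expf_neq0.
Qed.

(** The factor 2 of [delta_countE] leaves 2^n; with m = [uphalf k], the factor N^(n+1-2m) leaves the
    denominator N^(2m) of [collision]. *)
Lemma delta_collision N n : (0 < N)%N ->
  (delta_count 2 N n.+1)%:R / (2 * N)%:R ^+ n.+1 =
  \sum_(k < n.+1) binom_weight 2^-1 n k * collision N (uphalf k).
Proof.
move=> N0; have NN0 : N%:R != 0 :> R by rewrite pnatr_eq0 -lt0n.
rewrite delta_countE // natrM natr_sum mulrAC mulr_sumr; apply: eq_bigr => k _.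
have k2 : ((uphalf k).*2 <= n.+1)%N.
  by have := ltn_ord k; lia.
have -> : binom_weight 2^-1 n k = 'C(n, k)%:R / 2 ^+ n :> R.
  rewrite /binom_weight (_ : 1 - 2^-1 = 2^-1); last by field.
  by rewrite -mulrA -exprD subnKC -1?ltnS // exprVn.
have eN : N%:R ^+ n.+1 = N%:R ^+ (n.+1 - (uphalf k).*2) * N%:R ^+ uphalf k ^+ 2 :> R.
  by rewrite -exprM muln2 -exprD subnK.
rewrite !natrM natrX exprMn eN exprS /collision.
by field; rewrite !expf_neq0 ?pnatr_eq0 -?lt0n.
Qed.

(** Induction through [collisionS]: each new letter adds one factor sqrt(m), from the total mass of
    the squared weights. *)
Lemma collision_cvg (kappa : R) N : (0 < N)%N ->
    'C(j.*2, j)%:R / 4 ^+ j * Num.sqrt j%:R @[j --> \oo] --> kappa ->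
  collision N m * Num.sqrt m%:R ^+ N.-1 @[m --> \oo] -->
    Num.sqrt N%:R ^+ N * (kappa / 2) ^+ N.-1.
Proof.
move=> N0 cb; case: N N0 => // N _ /=; elim: N => [|N IH].
  rewrite sqrtr1 expr0 expr1 mulr1.
  by under eq_cvg => m do rewrite collision1 mul1r expr0; exact: cvg_cst.
pose s : R := N.+1%:R / N.+2%:R.
have N1 : 0 < N.+1%:R :> R by rewrite ltr0n.
have N2 : 0 < N.+2%:R :> R by rewrite ltr0n.
have s01 : 0 < s < 1 by rewrite divr_gt0 // ltr_pdivrMr // mul1r ltr_nat ltnSn.
have s01' : 0 <= s <= 1 by case/andP: s01 => a b; rewrite !ltW.
have bw0 n k : 0 <= binom_weight s n k by exact: binom_weight_ge0.
pose s' := 2 * s * (1 - s).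
have s'01 : 0 < s' < 1 by case/andP: s01 => a b; rewrite /s'; apply/andP; split; nra.
(* By [sum_binom_weight_sq] the mass is an average over even [k]: sqrt(2) comes from k/2, sqrt(s')
   from concentration at s'n, and 1/2 from the even mass. *)
have mass : (\sum_(k < n.+1) binom_weight s n k ^+ 2) * Num.sqrt n%:R ^+ 1
    @[n --> \oo] --> kappa * Num.sqrt 2 ^+ 1 / Num.sqrt s' ^+ 1 * 2^-1.
  under eq_cvg => n do rewrite sum_binom_weight_sq.
  apply: (@cvg_average R s' (fun n k => if odd k then 0 else binom_weight s' n k)
           (fun k => 'C(k./2.*2, k./2)%:R / 4 ^+ k./2) 1 0) => //.
  - move=> n k; have h : 0 <= binom_weight s' n k.
      by apply: binom_weight_ge0; case/andP: s'01 => a b; rewrite !ltW.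
    by case: odd; rewrite ?lexx h.
  - apply: (@cvg_power_law_half R (fun j => 'C(j.*2, j)%:R / 4 ^+ j) 1 kappa half).
      by move=> k; lia.
    by [].
  - by under eq_cvg => n do rewrite expr0 mulr1; exact: cvg_even_binom_mass.
(* Weights are at most 1, so their squares are dominated by the law itself, as [cvg_average]
   requires. *)
have wb n (k : 'I_n.+1) : 0 <= binom_weight s n k ^+ 2 <= binom_weight s n k.
  by rewrite exprn_ge0 //= -[leRHS]mulr1 ler_pM // binom_weight_le1.
have := @cvg_average R s (fun n k => binom_weight s n k ^+ 2) _ _ _ _ _ s01 wb IH mass.
have -> : Num.sqrt N.+1%:R ^+ N.+1 * (kappa / 2) ^+ N / Num.sqrt s ^+ N *
    (kappa * Num.sqrt 2 ^+ 1 / Num.sqrt s' ^+ 1 * 2^-1) =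
    Num.sqrt N.+2%:R ^+ N.+2 * (kappa / 2) ^+ N.+1.
  have u0 : Num.sqrt N.+1%:R != 0 :> R by rewrite gt_eqF // sqrtr_gt0.
  have t0 : Num.sqrt 2 != 0 :> R by rewrite gt_eqF // sqrtr_gt0.
  have v0 : Num.sqrt N.+2%:R != 0 :> R by rewrite gt_eqF // sqrtr_gt0.
  have vv : N.+2%:R = Num.sqrt N.+2%:R ^+ 2 :> R by rewrite sqr_sqrtr ?ler0n.
  have sE : Num.sqrt s = Num.sqrt N.+1%:R / Num.sqrt N.+2%:R.
    by rewrite sqrtrM ?ler0n // sqrtrV ?ler0n.
  have s'E : Num.sqrt s' = Num.sqrt 2 * Num.sqrt N.+1%:R / Num.sqrt N.+2%:R ^+ 2.
    have -> : s' = 2 * N.+1%:R / N.+2%:R ^+ 2.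
      have -> : 2 * N.+1%:R / N.+2%:R ^+ 2 = 2 * s * N.+2%:R^-1.
        by rewrite /s expr2 invfM !mulrA.
      congr (_ * _); apply: (mulIf (lt0r_neq0 N2)).
      by rewrite mulVf ?gt_eqF // mulrBl divfK ?gt_eqF // mul1r -[N.+2%:R]natr1 addrAC subrr add0r.
    rewrite sqrtrM ?mulr_ge0 ?ler0n // sqrtrV ?sqr_ge0 // sqrtr_sqr ger0_norm ?ler0n //.
    by rewrite sqrtrM ?ler0n // -vv.
  rewrite !expr1 sE s'E [(_ / Num.sqrt N.+2%:R) ^+ N]expr_div_n [(kappa / 2) ^+ N.+1]exprS.
  rewrite [Num.sqrt N.+1%:R ^+ N.+1]exprS [Num.sqrt N.+2%:R ^+ N.+2]exprS.
  rewrite [Num.sqrt N.+2%:R ^+ N.+1]exprS.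
  set a := Num.sqrt N.+1%:R ^+ N; set b := Num.sqrt N.+2%:R ^+ N.
  have a0 : a != 0 by rewrite expf_neq0.
  have b0 : b != 0 by rewrite expf_neq0.
  by field; rewrite a0 b0 u0 v0 t0.
by rewrite addn1; under [X in _ -> X]eq_cvg => m do rewrite collisionS //.
Qed.

(** Average at s = 1/2 with total mass 1. The factors sqrt(2) from [uphalf] and from [s] together
    cancel the 2 in [kappa / 2]. *)
Lemma delta_cvg (kappa : R) N : (0 < N)%N ->
    'C(j.*2, j)%:R / 4 ^+ j * Num.sqrt j%:R @[j --> \oo] --> kappa ->
  (delta_count 2 N p)%:R / (2 * N)%:R ^+ p * Num.sqrt p%:R ^+ N.-1 @[p --> \oo] -->
    Num.sqrt N%:R ^+ N * kappa ^+ N.-1.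
Proof.
move=> N0 cb.
have col := @cvg_power_law_half R _ _ _ uphalf _ (collision_cvg N0 cb).
have {col} : collision N (uphalf k) * Num.sqrt k%:R ^+ N.-1 @[k --> \oo] -->
    Num.sqrt N%:R ^+ N * (kappa / 2) ^+ N.-1 * Num.sqrt 2 ^+ N.-1.
  by apply: col => k; lia.
have h01 : 0 < (2^-1 : R) < 1 by apply/andP; split; lra.
have h01' : 0 <= (2^-1 : R) <= 1 by apply/andP; split; lra.
have wb n (k : 'I_n.+1) :
    0 <= (binom_weight 2^-1 n k : R) <= binom_weight 2^-1 n k.
  by rewrite lexx binom_weight_ge0.
have mass : (\sum_(k < n.+1) binom_weight (2^-1 : R) n k) * Num.sqrt n%:R ^+ 0
    @[n --> \oo] --> (1 : R).
  by under eq_cvg => n do rewrite sum_binom_weight mul1r; exact: cvg_cst.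
move=> /(@cvg_average R _ (binom_weight 2^-1) _ _ _ _ _ h01 wb) /(_ mass).
have -> : Num.sqrt N%:R ^+ N * (kappa / 2) ^+ N.-1 * Num.sqrt 2 ^+ N.-1 /
    Num.sqrt 2^-1 ^+ N.-1 * 1 = Num.sqrt N%:R ^+ N * kappa ^+ N.-1.
  rewrite mulr1 -!mulrA; congr (_ * _); rewrite -exprVn -!exprMn; congr (_ ^+ _).
  rewrite sqrtrV ?ler0n // invrK -expr2 sqr_sqrtr ?ler0n //.
  by rewrite divfK ?pnatr_eq0.
move=> avg; rewrite -(cvg_shiftS _ _).
(* The average is normalized by sqrt(n) although p = n + 1; this ratio corrects it. *)
have ratio : n.+1%:R / n%:R @[n --> \oo] --> (1 : R).
  apply/cvgrPdist_le => e e0; near=> n.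
  have n0 : 0 < n%:R :> R by rewrite ltr0n; near: n; exists 1%N.
  have -> : 1 - n.+1%:R / n%:R = - n%:R^-1 :> R.
    by rewrite -natr1 mulrDl divff ?gt_eqF // mul1r opprD addrA subrr sub0r.
  rewrite normrN ger0_norm ?invr_ge0 ?ler0n // -[e]invrK lef_pV2 ?posrE ?invr_gt0 //.
  near: n; exact: nbhs_infty_ger.
have h1 := cvgM avg (cvg_sqrt_expr (d := N.-1) ratio).
rewrite sqrtr1 expr1n mulr1 in h1.
apply: cvg_trans _ (h1 _ _); apply: near_eq_cvg; near=> n => /=.
have n0 : 0 < n%:R :> R by rewrite ltr0n; near: n; exists 1%N.
rewrite -delta_collision // addn0 sqrtrM ?ler0n // sqrtrV ?ler0n // expr_div_n.
have p0 : Num.sqrt n%:R ^+ N.-1 != 0 :> R by rewrite expf_neq0 // gt_eqF ?sqrtr_gt0.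
by rewrite -[LHS]mulrA [_ ^+ _ * (_ / _)]mulrC divfK.
Unshelve. all: by end_near. Qed.

Lemma cvg_central_binomial (w : R) : 0 < w ->
    (forall j, (0 < j)%N -> (w * (j%:R + 2^-1))^-1 <=
      ('C(j.*2, j)%:R / 4 ^+ j) ^+ 2 <= (w * j%:R)^-1) ->
  'C(j.*2, j)%:R / 4 ^+ j * Num.sqrt j%:R @[j --> \oo] --> (Num.sqrt w)^-1.
Proof.
move=> w0 bnd.
have sq : ('C(j.*2, j)%:R / 4 ^+ j) ^+ 2 * j%:R @[j --> \oo] --> w^-1.
  (* The lower bound is weakened by j/(j + 1/2) >= 1 - 1/j. *)
  apply: (@squeeze_cvgr _ _ _ _
    (fun j => w^-1 * (1 - (Num.sqrt j%:R)^-1 * (Num.sqrt j%:R)^-1)) (fun=> w^-1)).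
  - near=> j.
    have jN : (0 < j)%N by near: j; exists 1%N.
    have j0 : 0 < j%:R :> R by rewrite ltr0n.
    have /andP[lo hi] := bnd _ jN; apply/andP; split.
      rewrite -invfM -expr2 sqr_sqrtr ?ler0n // -ler_pdivrMr //.
      apply: le_trans lo; rewrite invfM -mulrA ler_pM2l ?invr_gt0 //.
      have jh : 0 < j%:R + 2^-1 :> R by rewrite addr_gt0 ?invr_gt0.
      rewrite -[leRHS]div1r ler_pdivlMr // -mulrA.
      have -> : j%:R^-1 * (j%:R + 2^-1) = 1 + j%:R^-1 / 2 :> R.
        by rewrite mulrDr mulVf ?gt_eqF.
      have : 0 < j%:R^-1 :> R by rewrite invr_gt0.
      by move: (j%:R^-1 : R) => v v0; nra.
    by apply: le_trans (ler_wpM2r (ltW j0) hi) _; rewrite invfM mulfVK ?gt_eqF.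
  - suff : w^-1 * (1 - (Num.sqrt j%:R)^-1 * (Num.sqrt j%:R)^-1) @[j --> \oo]
        --> w^-1 * (1 - 0 * 0) by rewrite mul0r subr0 mulr1.
    apply: cvgM; first exact: cvg_cst.
    apply: cvgB; first exact: cvg_cst.
    by apply: cvgM; exact: cvg_sqrt_natV.
  - exact: cvg_cst.
have := cvg_sqrt_expr (d := 1) sq; rewrite expr1 sqrtrV ?ltW // => h1.
apply: cvg_trans _ (h1 _); apply: near_eq_cvg; near=> j => /=.
rewrite expr1 sqrtrM ?sqr_ge0 // sqrtr_sqr ger0_norm //.
by rewrite divr_ge0 ?ler0n ?exprn_ge0.
Unshelve. all: by end_near. Qed.

(* To be used with [w = PI] of the standard library, which is not related to
   MathComp-Analysis' [pi]. *)
Lemma delta_equiv (w : R) N : (0 < N)%N -> 0 < w ->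
    (forall j, (0 < j)%N -> (w * (j%:R + 2^-1))^-1 <=
      ('C(j.*2, j)%:R / 4 ^+ j) ^+ 2 <= (w * j%:R)^-1) ->
  forall eps : R, 0 < eps -> exists M, forall p, (M <= p)%N ->
    `|(delta_count 2 N p)%:R / (2 * N)%:R ^+ p /
      Num.sqrt (N%:R ^+ N / (w * p%:R) ^+ (N - 1)) - 1| < eps.
Proof.
move=> N0 w0 bnd eps eps0.
have := delta_cvg N0 (cvg_central_binomial w0 bnd).
set l := Num.sqrt N%:R ^+ N * _ => dl.
have l0 : 0 < l.
  by rewrite mulr_gt0 // exprn_gt0 ?invr_gt0 ?sqrtr_gt0 // ltr0n.
have el0 : 0 < eps * l by rewrite mulr_gt0.
have [M _ hM] := (cvgrPdist_lt _ _).1 dl _ el0.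
exists M.+1 => p Mp.
have dlp := hM p (ltnW Mp).
have p0 : 0 < Num.sqrt p%:R ^+ N.-1 :> R.
  by rewrite exprn_gt0 // sqrtr_gt0 ltr0n (leq_trans _ Mp).
have -> : Num.sqrt (N%:R ^+ N / (w * p%:R) ^+ (N - 1)) = l / Num.sqrt p%:R ^+ N.-1.
  have sX (x : R) n : 0 <= x -> Num.sqrt (x ^+ n) = Num.sqrt x ^+ n.
    by move=> x0; elim: n => [|n IH]; rewrite ?sqrtr1 ?exprS ?sqrtrM ?IH.
  rewrite subn1 sqrtrM ?exprn_ge0 ?ler0n // sqrtrV ?exprn_ge0 ?mulr_ge0 ?ler0n ?ltW //.
  rewrite !sX ?mulr_ge0 ?ler0n ?ltW // sqrtrM ?ltW // exprMn /l exprVn.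
  by rewrite invfM mulrA.
rewrite -(ltr_pM2r l0) -[X in `|_| * X](gtr0_norm l0) -normrM mulrBl mul1r distrC.
by rewrite invf_div -[_ * (_ / l) * l]mulrA divfK ?gt_eqF.
Qed.
End CollisionProbability.

End Asymptotics.

(** * Transfer to the real numbers of the standard library *)

Module Conclusion.
Import all_boot all_order all_algebra ring zify reals Rstruct.
Import Wallis Counting Asymptotics.
Import Order.TTheory GRing.Theory Num.Theory.
Local Open Scope ring_scope.

Lemma central_binomial_PI (j : nat) : (0 < j)%N ->
  (PI * (j%:R + 2^-1))^-1 <= ('C(j.*2, j)%:R / 4 ^+ j) ^+ 2 <= (PI * j%:R)^-1.
Proof.
move=> j0.
have [|||lo hi] := @central_binomial_bounds (fun i => 'C(i.*2, i)%:R / 4 ^+ i) _ _ j.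
- by rewrite double0 bin0 expr0 divr1.
- move=> i; rewrite !INRE RmultE RdivE.
  (* The recurrence of C(2i, i) in natural numbers, with an extra factor [i.+1] that is cancelled in
     the reals. *)
  have e : (i.+1 * i.+1 * 'C(i.+1.*2, i.+1) = i.+1 * ((2 * i + 1) * 2 * 'C(i.*2, i)))%N.
    have e1 := mul_bin_diag i.+1.*2 i; have e2 := mul_bin_down i.*2.+1 i.
    rewrite doubleS /= in e1 e2 *.
    rewrite -mulnA -e1 (_ : i.*2.+2 = 2 * i.+1)%N; last by lia.
    rewrite (_ : i.*2.+1 - i = i.+1)%N in e2; last by lia.
    rewrite (_ : i.*2.+1 = 2 * i + 1)%N in e1 e2 *; last by lia.
    nia.
  have /(congr1 (fun k => GRing.one R *+ k)) := e; rewrite !natrM => eR.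
  have i0 : i.+1%:R != 0 :> R by rewrite pnatr_eq0.
  have -> : 'C(i.+1.*2, i.+1)%:R = (2 * i + 1)%:R * 2 * 'C(i.*2, i)%:R / i.+1%:R :> R.
    by apply: (mulfI i0); apply: (mulfI i0); rewrite mulrA eR [in RHS](mulrC _ (_ / _)) divfK.
  rewrite (_ : (2 * i + 2)%:R = 2 * i.+1%:R :> R); last by rewrite -natrM; congr _%:R; lia.
  have gen (a b x y : R) : x != 0 -> y != 0 ->
      a * 2 * b / x / (4 * y) = b / y * (a / (2 * x)).
    by move=> x0 y0; field; rewrite x0.
  by rewrite exprS; apply: gen => //; rewrite expf_neq0 // pnatr_eq0.
- exact/ssrnat.leP.
have two : IZR 2 = 2%:R :> R by rewrite IZRposE.
rewrite !INRE !RpowE ?two in lo hi.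
by apply/andP; split; apply/RleP.
Qed.

Lemma delta_Un_cv (N : nat) : (0 < N)%N ->
  Un_cv (fun p : nat => Rdiv (delta p 2 N)
     (R_sqrt.sqrt (Rdiv (pow (INR N) N) (pow (Rmult PI (INR p)) (Nat.sub N 1))))) (IZR 1).
Proof.
move=> N0 eps /RltP eps0.
have PI0 : 0 < PI :> R by apply/RltP; exact: PI_RGT_0.
have [M hM] := delta_equiv N0 PI0 central_binomial_PI eps0.
exists M => p Mp; apply/RltP; rewrite RdistE /delta.
rewrite !RpowE !INRE RsqrtE.
by apply: hM; apply/ssrnat.leP.
Qed.

End Conclusion.

Open Scope R_scope.

Theorem theorem6p4 (N : nat) (hN : (1 <= N)%nat) :
  Un_cv (fun p : nat => delta p 2 N / sqrt (INR N ^ N / (PI * INR p) ^ (N - 1)))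
        1.
Proof. exact (Conclusion.delta_Un_cv N (ssrbool.introT ssrnat.leP hN)). Qed.
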